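(* Let $G_\pm$ be a signed graph (without half-loops) on a finite multigraph $G=(V,E)$, and let $\tilde G\to G$ be the graph double covering which it parametrizes. Then there is a short exact sequence of critical groups $$0\longrightarrow K(G_\pm)\longrightarrow K(\tilde G)\longrightarrow K(G)\longrightarrow 0,$$ in which $K(\tilde G)\to K(G)$ is the surjection induced by the covering, and which splits on restriction to $p$-primary components for odd primes $p$. In particular, $|K(\tilde G)|=|K(G_\pm)|\cdot|K(G)|$.
   Context: Multigraphs $G=(V,E)$ are finite and undirected; multiple edges and self-loops are allowed. Fix an arbitrary orientation $e=(u,v)$ of each edge. For an unsigned multigraph let $\partial_G:\mathbb{Z}^E\to\mathbb{Z}^V$, $e=(u,v)\mapsto u-v$, with transpose $\partial_G^t$, and define the critical group $K(G):=\mathbb{Z}^E/(\operatorname{im}\partial_G^t+\ker\partial_G)\cong\operatorname{im}\partial_G/\operatorname{im}\partial_G\partial_G^t$ (isomorphism induced by $\partial_G$), a finite abelian group. A signed graph $G_\pm$ is a multigraph $G=(V,E)$ together with a map $E\to\{+,-\}$. Its node-edge incidence map $\partial=\partial_{G_\pm}:\mathbb{Z}^E\to\mathbb{Z}^V$ sends an edge $e$ oriented from $u$ to $v$ to $u-v$ if $e$ is positive and to $u+v$ if $e$ is negative (so a negative loop at $v$ is sent to $2v$ and a positive loop to $0$). Its critical group is $$K(G_\pm):=\operatorname{im}\partial/\operatorname{im}\partial\partial^t\cong\mathbb{Z}^E/(\operatorname{im}\partial^t+\ker\partial).$$ The double covering $\tilde G\to G$ parametrized by $G_\pm$: $\tilde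 G$ has two vertices $v_+,v_-$ above each vertex $v$ of $G$, and each edge $e=(u,v)$ of $G$ gives two edges $e_+,e_-$ of $\tilde G$, namely $e_+=(u_+,v_+)$, $e_-=(u_-,v_-)$ if $e$ is positive in $G_\pm$, and $e_+=(u_+,v_-)$, $e_-=(u_-,v_+)$ if $e$ is negative. The covering sends $v_\pm\mapsto v$ and $e_\pm\mapsto e$; the induced map $\mathbb{Z}^{\tilde E}\to\mathbb{Z}^E$ induces a surjection $K(\tilde G)\to K(G)$. *)

(* Defs.v *)
From HB Require Import structures.
From mathcomp Require Import all_boot all_order all_algebra.
From mathcomp Require Import finmap boolp classical_sets cardinality.

Set Implicit Arguments.
Unset Strict Implicit.
Unset Printing Implicit Defensive.

Import GRing.Theory.

Local Open Scope ring_scope.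
Local Open Scope quotient_scope.

(* Subgroups of an abelian group [A] are the [zmodClosed A] predicates. *)

Section Subgroups.
Variables A B : zmodType.

Definition im_pred (h : {additive A -> B}) : pred B :=
  fun y => `[< exists x, h x = y >].

Definition ker_pred (h : {additive A -> B}) : pred A := fun x => h x == 0.

Definition sum_pred (I J : zmodClosed A) : pred A :=
  fun x => `[< exists y z, [/\ y \in I, z \in J & x = y + z] >].

Definition pprim_pred (p : nat) : pred A :=
  fun x => `[< exists k : nat, x *+ (p ^ k) = 0 >].

Lemma im_zmod_closed h : zmod_closed (im_pred h).
Proof.
split; first by apply/asboolP; exists 0; rewrite raddf0.
by move=> _ _ /asboolP[x <-] /asboolP[y <-]; apply/asboolP; exists (x - y); rewrite raddfB.
Qed.
HB.instance Definition _ h :=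
  GRing.isZmodClosed.Build B (im_pred h) (im_zmod_closed h).

Lemma ker_zmod_closed h : zmod_closed (ker_pred h).
Proof.
split; first by rewrite unfold_in /ker_pred raddf0.
move=> x y; rewrite !unfold_in /ker_pred => /eqP hx /eqP hy.
by rewrite raddfB hx hy subr0.
Qed.
HB.instance Definition _ h :=
  GRing.isZmodClosed.Build A (ker_pred h) (ker_zmod_closed h).

Lemma sum_zmod_closed I J : zmod_closed (sum_pred I J).
Proof.
split; first by apply/asboolP; exists 0, 0; rewrite !rpred0 addr0.
move=> _ _ /asboolP[x [y [Ix Jy ->]]] /asboolP[z [t [Iz Jt ->]]].
by apply/asboolP; exists (x - z), (y - t); rewrite !rpredB // opprD addrACA.
Qed.
HB.instance Definition _ I J :=
  GRing.isZmodClosed.Build A (sum_pred I J) (sum_zmod_closed I J).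

Lemma pprim_zmod_closed p : zmod_closed (pprim_pred p).
Proof.
split; first by apply/asboolP; exists 0%N; rewrite mul0rn.
move=> x y /asboolP[k hk] /asboolP[l hl]; apply/asboolP; exists (k + l)%N.
by rewrite mulrnBl expnD mulrnA hk mulnC mulrnA hl !mul0rn subr0.
Qed.
HB.instance Definition _ p :=
  GRing.isZmodClosed.Build A (pprim_pred p) (pprim_zmod_closed p).

Definition im (h : {additive A -> B}) : zmodClosed B := GRing.ZmodClosed.clone B (im_pred h) _.
Definition ker (h : {additive A -> B}) : zmodClosed A := GRing.ZmodClosed.clone A (ker_pred h) _.
Definition sum_subgroup (I J : zmodClosed A) : zmodClosed A :=
  GRing.ZmodClosed.clone A (sum_pred I J) _.
Definition pprim (p : nat) : zmodClosed A := GRing.ZmodClosed.clone A (pprim_pred p) _.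

End Subgroups.

Section SubgroupAsGroup.
Variables (A : zmodType) (I : zmodClosed A).

Definition subgroup := {x : A | x \in I}.
HB.instance Definition _ := SubChoice.on subgroup.
HB.instance Definition _ := [SubChoice_isSubZmodule of subgroup by <:].

Definition within_pred (J : zmodClosed A) : pred subgroup :=
  fun x => val x \in J.

Lemma within_zmod_closed J : zmod_closed (@within_pred J).
Proof.
split; first by rewrite unfold_in /within_pred raddf0 rpred0.
by move=> x y; rewrite !unfold_in /within_pred raddfB => Jx Jy; apply: rpredB.
Qed.
HB.instance Definition _ J :=
  GRing.isZmodClosed.Build subgroup (within_pred J) (@within_zmod_closed J).

Definition within (J : zmodClosed A) : zmodClosed subgroup :=
  GRing.ZmodClosed.clone subgroup (within_pred J) _.

End SubgroupAsGroup.

(* The quotient of [I] by [I :&: J]; used below with [J] contained in [I]. *)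
Definition subquotient (A : zmodType) (I J : zmodClosed A) : zmodType :=
  {ideal_quot (@within A I J)}.

Definition pprimary (p : nat) (A : zmodType) : zmodType :=
  subgroup (pprim A p).

Section PPrimaryMap.
Variables (p : nat) (A B : zmodType) (h : {additive A -> B}).

Lemma pprim_map_subproof (x : pprimary p A) : h (val x) \in pprim B p.
Proof.
case: x => x /= /asboolP[k hk]; apply/asboolP; exists k.
by rewrite -raddfMn hk raddf0.
Qed.

Definition pprim_map (x : pprimary p A) : pprimary p B :=
  exist _ (h (val x)) (pprim_map_subproof x).

Lemma pprim_map_is_zmod_morphism : zmod_morphism pprim_map.
Proof. by move=> x y; apply: val_inj; rewrite /= raddfB. Qed.
HB.instance Definition _ :=
  GRing.isZmodMorphism.Build (pprimary p A) (pprimary p B) pprim_map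
    pprim_map_is_zmod_morphism.

End PPrimaryMap.

Arguments pprim_map p {A B} h x.

Definition short_exact (A B C : zmodType)
    (i : {additive A -> B}) (q : {additive B -> C}) : Prop :=
  [/\ injective i,
      forall b, q b = 0 <-> exists a, i a = b
    & forall c, exists b, q b = c].

Definition split_short_exact (A B C : zmodType)
    (i : {additive A -> B}) (q : {additive B -> C}) : Prop :=
  short_exact i q /\ exists s : {additive C -> B}, cancel s q.

(* [fset_set] is empty on an infinite set, so this is meaningful only when
   [T] is finite. *)
Definition group_order (T : choiceType) : nat := #|` fset_set [set: T]%classic|%fset.

Notation "'Z^' T" := {ffun T -> int}
  (at level 8, T at level 2, format "'Z^' T") : type_scope.

Section FreeModules.
Variables S T : finType.

Definition basis_vec (t : T) : Z^T := [ffun u => (u == t)%:R].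

Definition lin_ext (f : S -> Z^T) (x : Z^S) : Z^T := \sum_s f s *~ x s.

Lemma lin_ext_is_zmod_morphism f : zmod_morphism (lin_ext f).
Proof.
move=> x y; rewrite /lin_ext -sumrB; apply: eq_bigr => s _.
by rewrite !ffunE mulrzBr.
Qed.
HB.instance Definition _ f :=
  GRing.isZmodMorphism.Build (Z^S) (Z^T) (lin_ext f) (lin_ext_is_zmod_morphism f).

End FreeModules.

(* The map whose matrix is the transpose of that of [lin_ext f]. *)
Definition lin_ext_tr (S T : finType) (f : S -> Z^T) : {additive Z^T -> Z^S} :=
  lin_ext (fun t => [ffun s => f s t]).

(* [src] and [tgt] fix an orientation of each edge; parallel edges and loops are
   allowed, and every edge has two ends, so there are no half-loops. *)
Record multigraph := Multigraph {
  vertex : finType;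
  edge : finType;
  src : edge -> vertex;
  tgt : edge -> vertex }.

Record signed_graph := SignedGraph {
  underlying :> multigraph;
  is_positive : edge underlying -> bool }.

Definition incidence (G : multigraph) (e : edge G) : Z^(vertex G) :=
  basis_vec (src e) - basis_vec (tgt e).

Definition signed_incidence (G : signed_graph) (e : edge G) : Z^(vertex G) :=
  if is_positive e then basis_vec (src e) - basis_vec (tgt e)
  else basis_vec (src e) + basis_vec (tgt e).

Definition boundary (G : multigraph) : {additive Z^(edge G) -> Z^(vertex G)} :=
  lin_ext (@incidence G).

Definition coboundary (G : multigraph) : {additive Z^(vertex G) -> Z^(edge G)} :=
  lin_ext_tr (@incidence G).

Definition signed_boundary (G : signed_graph) :
    {additive Z^(edge G) -> Z^(vertex G)} :=
  lin_ext (@signed_incidence G).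

Definition signed_coboundary (G : signed_graph) :
    {additive Z^(vertex G) -> Z^(edge G)} :=
  lin_ext_tr (@signed_incidence G).

Definition crit_relations (G : multigraph) : zmodClosed (Z^(edge G)) :=
  sum_subgroup (im (coboundary G)) (ker (boundary G)).

Definition crit (G : multigraph) : zmodType := {ideal_quot (crit_relations G)}.

Definition crit_class (G : multigraph) (x : Z^(edge G)) : crit G :=
  \pi_{ideal_quot (crit_relations G)} x.

Definition signed_crit (G : signed_graph) : zmodType :=
  subquotient (im (signed_boundary G))
    (im (signed_boundary G \o signed_coboundary G)).

(* The boolean is the sheet: [(v, true)] is v_+ and [(v, false)] is v_-. *)
Definition double_cover (G : signed_graph) : multigraph :=
  @Multigraph (vertex G * bool)%type (edge G * bool)%type
    (fun e => (src e.1, e.2))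
    (fun e => (tgt e.1, if is_positive e.1 then e.2 else ~~ e.2)).

Definition cover_map (G : signed_graph) :
    {additive Z^(edge (double_cover G)) -> Z^(edge G)} :=
  lin_ext (fun e : edge (double_cover G) => basis_vec e.1).

(* Main.v *)
Require Import Defs.
From mathcomp Require Import all_boot all_order all_algebra.
From mathcomp Require Import finmap boolp classical_sets cardinality.
From mathcomp Require Import ring.
From HB Require Import structures.

(** Write d and d' for the boundary map and its transpose, with a tilde on the
    double cover and a sign on the signed graph.  The covering pushes edge
    vectors of the double cover forward by adding the two sheets, and the
    vectors that push to 0 are the antisymmetric ones [anti x], on which the
    boundary of the double cover acts as the signed boundary.  Hence the kernel
    of K(G~) -> K(G) is made of the classes that have a representative with
    antisymmetric boundary, and it is computed to be
<<
      sat(im d_+-) / d_+- (sat(im d'_+-)),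
>>
    where sat is saturation: the vectors with a nonzero multiple in the
    subgroup ([anti_boundaryP], [anti_laplacianP]).  Both computations rest on
    the images of the boundary and of the coboundary of an unsigned graph being
    saturated: for the coboundary, divide a potential by k and round down
    ([sat_coboundary]); the boundary follows by duality ([sat_im_of_tr]).

    This kernel is the Pontryagin dual of K(G_+-), not K(G_+-) itself: the map
    sending the class of e to that of e_+ - e_- is in general not injective.
    For a single vertex with one negative loop, K(G_+-) = im d_+- / im d_+- d'_+-
    is 2Z/4Z, the kernel is Z/2Z, and that map is zero.  As a finite abelian
    group is isomorphic to its dual, an isomorphism exists, but it is not
    canonical; it is extracted from a Smith normal form in
    [critical_duality], which is stated for an arbitrary integer matrix.

    The splitting uses the transfer K(G) -> K(G~) that sums the two lifts of an
    edge: followed by the covering map it is multiplication by 2, which is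
    invertible on p-primary parts for odd p.  Finiteness of every critical
    group comes from [crit_lattice_exponent]: a basis vector of infinite order
    would give a vector orthogonal both to im d' and to ker d = (im d')^perp,
    hence to itself. *)

Set Implicit Arguments.
Unset Strict Implicit.
Unset Printing Implicit Defensive.
Import Order.TTheory GRing.Theory Num.Theory.

Local Open Scope ring_scope.

(** * The integral pairing and transposes *)

Definition dot (T : finType) (x y : Z^T) : int := \sum_t x t * y t.

Section Dot.
Variable T : finType.
Implicit Types x y : Z^T.

Lemma dotC x y : dot x y = dot y x.
Proof. by apply: eq_bigr => t _; rewrite mulrC. Qed.

Lemma dot_is_zmod_morphism x : zmod_morphism (dot x).
Proof.
move=> y z; rewrite /dot -sumrB; apply: eq_bigr => t _.
by rewrite !ffunE mulrBr.
Qed.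
HB.instance Definition _ x :=
  GRing.isZmodMorphism.Build (Z^T) int (dot x) (dot_is_zmod_morphism x).

Lemma dotBl x y z : dot (x - y) z = dot x z - dot y z.
Proof. by rewrite ![dot _ z]dotC raddfB. Qed.

Lemma dotDl x y z : dot (x + y) z = dot x z + dot y z.
Proof. by rewrite ![dot _ z]dotC raddfD. Qed.

Lemma dotMzl x y (n : int) : dot (x *~ n) y = dot x y * n.
Proof. by rewrite ![dot _ y]dotC raddfMz mulrzz. Qed.

Lemma dotMzr x y (n : int) : dot x (y *~ n) = dot x y * n.
Proof. by rewrite raddfMz mulrzz. Qed.

Lemma ffunMz x (n : int) t : (x *~ n) t = x t * n.
Proof.
case: n => n; rewrite ?NegzE ?mulrNz ?ffunE -pmulrn ffunMnE -mulr_natr natz //.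
by rewrite mulrN.
Qed.

Lemma dot_basisr x t : dot x (basis_vec t) = x t.
Proof.
rewrite /dot (bigD1 t) //= big1 => [|u neq]; rewrite ffunE.
  by rewrite eqxx mulr1 addr0.
by rewrite (negPf neq) mulr0.
Qed.

Lemma dot_eq0 x : dot x x = 0 -> x = 0.
Proof.
move/psumr_eq0P => x0; apply/ffunP => t; rewrite ffunE.
apply/eqP; rewrite -sqrf_eq0 expr2 x0 // => u _; exact: sqr_ge0.
Qed.

Lemma dvd_vec x (n : int) : (forall t, (n %| x t)%Z) -> exists y, x = y *~ n.
Proof.
move=> dvd; exists [ffun t => (x t %/ n)%Z]; apply/ffunP => t.
by rewrite ffunMz ffunE divzK.
Qed.

End Dot.

Lemma lin_extE (S T : finType) (f : S -> Z^T) x t : lin_ext f x t = \sum_s f s t * x s.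
Proof. by rewrite sum_ffunE; apply: eq_bigr => s _; rewrite ffunMz. Qed.

Section Matrices.
Variables S T : finType.
Implicit Types (f : S -> Z^T) (x : Z^S) (y : Z^T).

Lemma lin_ext_basis f s : lin_ext f (basis_vec s) = f s.
Proof.
apply/ffunP => t; rewrite lin_extE.
rewrite (bigD1 s) //= big1 => [|u neq]; rewrite ffunE.
  by rewrite eqxx mulr1 addr0.
by rewrite (negPf neq) mulr0.
Qed.

Lemma lin_ext_trE f y s : lin_ext_tr f y s = dot (f s) y.
Proof.
by rewrite /lin_ext_tr /= lin_extE; apply: eq_bigr => t _; rewrite ffunE.
Qed.

Lemma lin_ext_adj f x y : dot (lin_ext f x) y = dot x (lin_ext_tr f y).
Proof.
rewrite /dot; under eq_bigr => t _ do rewrite lin_extE big_distrl.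
rewrite exchange_big; apply: eq_bigr => s _ /=.
rewrite lin_ext_trE big_distrr; apply: eq_bigr => t _ /=.
by rewrite mulrAC mulrC.
Qed.

Lemma additiveE (A : zmodType) (h : {additive Z^S -> A}) x :
  h x = \sum_s h (basis_vec s) *~ x s.
Proof.
have {1}-> : x = \sum_s basis_vec s *~ x s.
  apply/ffunP => t; rewrite sum_ffunE -[LHS]dot_basisr dotC.
  by apply: eq_bigr => s _; rewrite ffunMz !ffunE eq_sym.
by rewrite raddf_sum; apply: eq_bigr => s _; rewrite raddfMz.
Qed.

Lemma additive_ext (A : zmodType) (h k : {additive Z^S -> A}) :
  (forall s, h (basis_vec s) = k (basis_vec s)) -> h =1 k.
Proof. by move=> hk x; rewrite !additiveE; apply: eq_bigr => s _; rewrite hk. Qed.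

End Matrices.

(** * Smith normal form as a pair of dual bases *)

Definition rowv (T : finType) (x : Z^T) : 'rV[int]_#|T| :=
  \row_i x (enum_val i).
Definition unrowv (T : finType) (r : 'rV[int]_#|T|) : Z^T :=
  [ffun t => r 0 (enum_rank t)].
Lemma rowvK T : cancel (@rowv T) (@unrowv T).
Proof. by move=> x; apply/ffunP => t; rewrite ffunE mxE enum_rankK. Qed.
Lemma unrowvK T : cancel (@unrowv T) (@rowv T).
Proof. by move=> x; apply/rowP => i; rewrite mxE ffunE enum_valK. Qed.

(** The dual bases are the rows of [R] and the columns of its inverse in a Smith
    form [L *m D *m R] of the matrix of [g]; left multiplication by the unimodular
    [L] does not change the row span.  The divisor of a basis vector beyond the
    rank is 0, so that divisibility forces that coordinate to vanish. *)
Lemma stacked_basis (S T : finType) (g : S -> Z^T) :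
  exists (b c : T -> Z^T) (d : T -> int),
  [/\ forall x, x = \sum_i c i *~ dot x (b i),
      forall i j, dot (b i) (c j) = (i == j)%:R
    & forall x, (exists y, lin_ext g y = x) <->
        forall i, (d i %| dot x (c i))%Z].
Proof.
pose M : 'M[int]_(#|S|, #|T|) := \matrix_(i, j) g (enum_val i) (enum_val j).
have gM y : rowv (lin_ext g y) = rowv y *m M.
  apply/rowP => j; rewrite !mxE lin_extE (reindex _ (onW_bij _ (@enum_val_bij S))) /=.
  by apply: eq_bigr => i _; rewrite !mxE mulrC.
have [L uL [R uR [d _ ME]]] := int_Smith_normal_form M.
pose b t := unrowv (row (enum_rank t) R).
pose c t : Z^T := [ffun u => invmx R (enum_rank u) (enum_rank t)].
have bv t u : b t u = R (enum_rank t) (enum_rank u) by rewrite !ffunE !mxE.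
have cv t u : c t u = invmx R (enum_rank u) (enum_rank t) by rewrite ffunE.
have rk : {on [pred i | true], bijective (@enum_rank T)} := onW_bij _ (@enum_rank_bij T).
have bc i j : dot (b i) (c j) = (i == j)%:R.
  rewrite /dot; under eq_bigr do rewrite bv cv.
  rewrite -(reindex _ rk (F := fun k => R (enum_rank i) k * invmx R k (enum_rank j))) /=.
  have /matrixP/(_ (enum_rank i) (enum_rank j)) := mulmxV uR.
  by rewrite !mxE (inj_eq enum_rank_inj) => ->.
have cb i j : \sum_t c t i * b t j = (i == j)%:R.
  under eq_bigr do rewrite bv cv.
  rewrite -(reindex _ rk (F := fun k => invmx R (enum_rank i) k * R k (enum_rank j))) /=.
  have /matrixP/(_ (enum_rank i) (enum_rank j)) := mulVmx uR.
  by rewrite !mxE (inj_eq enum_rank_inj) => ->.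
have cE x : x = \sum_t c t *~ dot x (b t).
  apply/ffunP => j; rewrite sum_ffunE.
  under eq_bigr => t _ do rewrite ffunMz /dot big_distrr.
  rewrite exchange_big /=.
  under eq_bigr => i _.
    under eq_bigr => t _ do rewrite mulrC -mulrA [b t i * _]mulrC.
    rewrite -big_distrr cb /=. over.
  rewrite (bigD1 j) //= big1 => [|i /negPf ne]; last by rewrite eq_sym ne mulr0.
  by rewrite eqxx mulr1 addr0.
pose e (t : T) : int := if (enum_rank t < #|S|)%N then d`_(enum_rank t) else 0.
have rdot x t : (rowv x *m invmx R) 0 (enum_rank t) = dot x (c t).
  rewrite !mxE (reindex _ rk) /dot; apply: eq_bigr => u _.
  by rewrite mxE cv enum_rankK.
exists b, c, e; split=> //.
move=> x; pose D : 'M[int]_(#|S|, #|T|) := \matrix_(i, j) (d`_i *+ (i == j :> nat)).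
have uD (u : 'rV[int]_#|S|) t : (u *m D) 0 (enum_rank t) =
    (if insub (enum_rank t : nat) is Some i then u 0 i else 0) * e t.
  rewrite mxE /e; case: insubP => [i lt ei|ge].
    rewrite lt (bigD1 i) //= big1 => [|k ne]; rewrite mxE.
      by rewrite -ei eqxx mulr1n addr0.
    by rewrite -ei [_ == _ :> nat](negPf ne) mulr0n mulr0.
  rewrite (negPf ge) mulr0 big1 // => k _; rewrite mxE.
  case: eqP => [ek|_]; last by rewrite mulr0n mulr0.
  by rewrite -ek ltn_ord in ge.
split=> [[y <-] t|dvd].
  by rewrite -rdot gM ME mulmxA mulmxK // mulmxA uD dvdz_mull.
pose u : 'rV[int]_#|S| := \row_i
  if insub (i : nat) is Some j then (dot x (c (enum_val (j : 'I_#|T|))) %/ d`_i)%Z else 0.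
exists (unrowv (u *m invmx L)); apply: (can_inj (@rowvK T)).
rewrite gM unrowvK ME !mulmxA mulmxKV //; apply: (can_inj (mulmxKV uR)).
rewrite mulmxK //; apply/rowP => j; rewrite -[j]enum_valK uD rdot.
move: (dvd (enum_val j)); rewrite /e enum_valK.
case: insubP => [i lt ei|ge]; last by rewrite (negPf ge) mulr0 dvd0z => /eqP->.
rewrite lt mxE; case: insubP => [k _ ek|]; last by rewrite ei ltn_ord.
have -> : k = j by apply: val_inj; rewrite /= ek ei.
by rewrite ei => /divzK.
Qed.

(** * Saturation, kernels and the relation lattice of an integer matrix *)

(** The saturation of the image of [h]. *)
Definition sat (S T : finType) (h : {additive Z^S -> Z^T}) (x : Z^T) : Prop :=
  exists2 k : int, k != 0 & exists y, h y = x *~ k.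

(** The relations of the edge presentation of a critical group, for an arbitrary
    matrix so as to cover signed and unsigned incidence matrices alike. *)
Definition crit_lattice (S T : finType) (f : S -> Z^T) : zmodClosed (Z^S) :=
  sum_subgroup (im (lin_ext_tr f)) (ker (lin_ext f)).

Lemma crit_latticeP (S T : finType) (f : S -> Z^T) x :
  x \in crit_lattice f <->
  exists u z, lin_ext f z = 0 /\ x = lin_ext_tr f u + z.
Proof.
split=> [/asboolP[y [z [/asboolP[u <-] /eqP fz ->]]]|[u [z [fz ->]]]].
  by exists u, z.
apply/asboolP; exists (lin_ext_tr f u), z; split=> //; last exact/eqP.
by apply/asboolP; exists u.
Qed.

Lemma mulz_ffun_inj (T : finType) (k : int) (x y : Z^T) :
  k != 0 -> x *~ k = y *~ k -> x = y.
Proof.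
move=> k0 /ffunP xy; apply/ffunP => t; apply: (mulIf k0).
by rewrite -!ffunMz.
Qed.

Lemma dvd_sum (I : finType) (n : int) (F : I -> int) :
  (forall i, (n %| F i)%Z) -> (n %| \sum_i F i)%Z.
Proof. move=> dvd; apply: rpred_sum => i _; apply: dvd. Qed.

Section Lattice.
Variables (S T : finType) (f : S -> Z^T).
Local Notation F := (lin_ext f).
Local Notation Ft := (lin_ext_tr f).

(** In a basis adapted to the image of [Ft], a vector orthogonal to [ker F]
    has no component along the basis vectors with divisor 0, whose dual vectors
    lie in [ker F]; the product of the other divisors is then a multiple that
    works. *)
Lemma perp_ker y : (forall z, F z = 0 -> dot y z = 0) -> sat Ft y.
Proof.
move=> perp; have [b [c [d [_ _ imP]]]] := stacked_basis (fun t => [ffun s => f s t]).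
pose k := \prod_(i | d i != 0) d i; exists k.
  by apply/prodf_neq0 => i.
apply/(imP _) => i; rewrite dotMzl; have [di|di] := eqVneq (d i) 0.
  rewrite perp ?mul0r ?dvdz0 //; apply: dot_eq0; rewrite lin_ext_adj dotC.
  have [/(_ (ex_intro _ _ erefl))] := imP (Ft (F (c i))).
  by move/(_ i); rewrite di dvd0z => /eqP.
by rewrite /k (bigD1 i) //= dvdz_mull // dvdz_mulr.
Qed.

Lemma sat_perp y z : sat Ft y -> F z = 0 -> dot y z = 0.
Proof.
move=> [k k0 [u yk]] Fz; apply: (mulIf k0); rewrite mul0r -dotMzl -yk dotC.
by rewrite -lin_ext_adj Fz dotC raddf0.
Qed.

(** A vector of [ker F] that is also orthogonal to [ker F] has norm 0. *)
Lemma sat_ker0 y : sat Ft y -> F y = 0 -> y = 0.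
Proof. by move=> sy Fy; apply: dot_eq0; apply: sat_perp. Qed.

(** [ker F] is a direct summand: [P] is the projection on the span of the dual
    basis vectors with divisor 0.  Its transpose [Q] serves to make vectors
    orthogonal to [ker F]. *)
Lemma ker_projection : exists P Q : {additive Z^S -> Z^S},
  [/\ forall x, F (P x) = 0, forall x, F x = 0 -> P x = x
    & forall x y, dot (P x) y = dot x (Q y)].
Proof.
have [b [c [d [cE bc imP]]]] := stacked_basis (fun t => [ffun s => f s t]).
pose p i := if d i == 0 then c i else 0.
exists (lin_ext p \o lin_ext_tr b), (lin_ext b \o lin_ext_tr p); split=> /=.
- move=> x; have -> : F (lin_ext p (lin_ext_tr b x)) =
    \sum_i F (p i) *~ lin_ext_tr b x i.
    by rewrite raddf_sum; apply: eq_bigr => i _; rewrite raddfMz.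
  rewrite big1 // => i _; rewrite /p; have [di|] := eqVneq (d i) 0; last by rewrite !raddf0 mul0rz.
  suff -> : F (c i) = 0 by rewrite mul0rz.
  apply: dot_eq0; rewrite lin_ext_adj dotC.
  have [/(_ (ex_intro _ _ erefl))] := imP (Ft (F (c i))).
  by move/(_ i); rewrite di dvd0z => /eqP.
- move=> x Fx; rewrite [RHS]cE; apply: eq_bigr => i _.
  rewrite lin_ext_trE dotC /p; have [di|di] := eqVneq (d i) 0; first by [].
  suff -> : dot x (b i) = 0 by rewrite !mulr0z.
  have [_ /(_ _)[j|u ub]] := imP (b i *~ d i).
    rewrite dotMzl bc; have [->|] := eqVneq i j; first by rewrite mul1r.
    by rewrite mul0r dvdz0.
  apply: (mulIf di); rewrite mul0r -dotMzr -ub.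
  by apply: etrans (esym (lin_ext_adj _ _ _)) _; rewrite Fx dotC raddf0.
- by move=> x y; rewrite lin_ext_adj dotC [RHS]dotC lin_ext_adj.
Qed.

(** Exhibits the lattice as the image of one integer matrix, to which the Smith
    normal form applies. *)
Lemma crit_lattice_generators : exists g : T + S -> Z^S,
  forall x, (exists y, lin_ext g y = x) <-> x \in crit_lattice f.
Proof.
have [P [Q [FP Pid _]]] := ker_projection.
pose g (i : T + S) := match i with
  inl t => Ft (basis_vec t) | inr s => P (basis_vec s) end.
have gE y : lin_ext g y = Ft [ffun t => y (inl t)] + P [ffun s => y (inr s)].
  rewrite {1}/lin_ext big_sumType /= [Ft _]additiveE [P _]additiveE.
  by congr (_ + _); apply: eq_bigr => i _; rewrite ffunE.
exists g => x; split=> [[y <-]|/crit_latticeP[u [z [Fz ->]]]].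
  by apply/crit_latticeP; rewrite gE; exists [ffun t => y (inl t)], (P [ffun s => y (inr s)]).
exists [ffun i => match i with inl t => u t | inr s => z s end].
rewrite gE; congr (Ft _ + _); first by apply/ffunP => t; rewrite !ffunE.
by rewrite -[RHS]Pid //; congr (P _); apply/ffunP => s; rewrite !ffunE.
Qed.

(** The quotient by the relation lattice is finite: a vanishing divisor would
    give a dual basis vector [c i] orthogonal to the whole lattice.  Being
    orthogonal to [im Ft] it lies in [ker F], so it is orthogonal to itself. *)
Lemma crit_lattice_exponent :
  exists2 n : nat, (0 < n)%N & forall x, x *+ n \in crit_lattice f.
Proof.
have [g gP] := crit_lattice_generators.
have [b [c [d [_ bc imP]]]] := stacked_basis g.
have mem x : x \in crit_lattice f <-> forall i, (d i %| dot x (c i))%Z.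
  exact: iff_trans (iff_sym (gP x)) (imP x).
have d0 i : d i != 0.
  apply/eqP => di.
  have perp x : x \in crit_lattice f -> dot x (c i) = 0.
    by move/mem/(_ i); rewrite di dvd0z => /eqP.
  have Fc : F (c i) = 0.
    apply: dot_eq0; rewrite lin_ext_adj dotC; apply: perp; apply/crit_latticeP.
    by exists (F (c i)), 0; rewrite raddf0 addr0.
  have c0 : c i = 0.
    apply: dot_eq0; apply: perp; apply/crit_latticeP.
    by exists 0, (c i); rewrite raddf0 add0r.
  by have := bc i i; rewrite c0 eqxx raddf0.
exists `|(\prod_i d i)%R|%N; first by rewrite absz_gt0; apply/prodf_neq0.
move=> x; apply/mem => i; rewrite pmulrn dotMzl dvdz_mull // dvdzE absz_id -dvdzE.
by rewrite (bigD1 i) //= dvdz_mulr.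
Qed.

End Lattice.

(** Let [L] be the image of [g], which contains [n Z^S].  The dual group of
    [Z^S / L] is [L* / n Z^S], where [L*] consists of the vectors pairing with
    [L] in [n Z].  In bases adapted to [L] with divisors [d i], multiplying the
    i-th coordinate by [n / d i] induces an isomorphism from the group to its
    dual. *)
Lemma lattice_self_dual (R S : finType) (g : R -> Z^S) (n : int) :
  n != 0 -> (forall x, exists y, lin_ext g y = x *~ n) ->
  exists phi : {additive Z^S -> Z^S},
  [/\ forall x, (exists y, lin_ext g y = x) <-> exists m, phi x = m *~ n,
      forall x r, (n %| dot (phi x) (g r))%Z
    & forall y, (forall r, (n %| dot y (g r))%Z) -> exists x, phi x = y].
Proof.
move=> n0 fin; have [b [c [d [cE bc imP]]]] := stacked_basis g.
have dn i : (d i %| n)%Z.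
  by have [/(_ (fin (b i)))/(_ i)] := imP (b i *~ n); rewrite dotMzl bc eqxx mul1r.
pose w i := (n %/ d i)%Z.
have wd i : w i * d i = n by rewrite divzK.
have w0 i : w i != 0 by apply: contraNneq n0 => wi; rewrite -(wd i) wi mul0r.
have d0 i : d i != 0 by apply: contraNneq n0 => di; rewrite -(wd i) di mulr0.
have cb i j : dot (c i) (b j) = (i == j)%:R by rewrite dotC bc eq_sym.
pose phi := lin_ext (fun i => c i *~ w i) \o lin_ext_tr c.
have phiE x y : dot (phi x) y = \sum_i w i * dot x (c i) * dot (c i) y.
  rewrite dotC raddf_sum; apply: eq_bigr => i _.
  by rewrite /= lin_ext_trE [dot (c i) x]dotC !dotMzr [dot y _]dotC -mulrA mulrC.
have phib x j : dot (phi x) (b j) = w j * dot x (c j).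
  rewrite phiE (bigD1 j) //= big1 => [|i /negPf ne]; last by rewrite cb ne mulr0.
  by rewrite cb eqxx mulr1 addr0.
exists phi; split=> [x|x r|y dvd].
- split=> [/imP dvd|[m phim]].
    exists (\sum_i c i *~ (dot x (c i) %/ d i)%Z); rewrite [LHS]cE mulrz_suml.
    apply: eq_bigr => i _; rewrite phib -mulrzA; congr (_ *~ _).
    by rewrite -(wd i) -[LHS]mulrC -{1}(divzK (dvd i)) -mulrA [d i * _]mulrC.
  have {}phim : phi x = m *~ n := phim.
  apply/imP => i; rewrite -(dvdz_mul2l (w0 i)) wd -phib phim dotMzl.
  exact: dvdz_mull.
- rewrite phiE dvd_sum // => i; rewrite -(wd i) -mulrA dvdz_mul //.
  by rewrite dvdz_mull // dotC; apply: (proj1 (imP _)); exists (basis_vec r); rewrite lin_ext_basis.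
- have wdvd i : (w i %| dot y (b i))%Z.
    rewrite -(dvdz_mul2r (d0 i)) wd -dotMzr.
    have [|u <-] := proj2 (imP (b i *~ d i)).
      move=> j; rewrite dotMzl bc; have [->|] := eqVneq i j; first by rewrite mul1r.
      by rewrite mul0r dvdz0.
    rewrite raddf_sum dvd_sum // => r /=; rewrite dotMzr dvdz_mulr //.
  exists (\sum_i b i *~ (dot y (b i) %/ w i)%Z).
  rewrite [LHS]cE [RHS]cE; apply: eq_bigr => j _; congr (_ *~ _).
  rewrite phib dotC raddf_sum (bigD1 j) //= big1 => [|i /negPf ne]; last first.
    by rewrite dotMzr cb eq_sym ne mul0r.
  by rewrite dotMzr cb eqxx mul1r addr0 mulrC divzK.
Qed.

(** * Self-duality of critical groups *)

Section Duality.
Variables (S T : finType) (f : S -> Z^T).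
Local Notation F := (lin_ext f).
Local Notation Ft := (lin_ext_tr f).

Lemma dot_crit_lattice x v k u z :
  F x = v *~ k -> sat Ft x -> F z = 0 -> dot x (Ft u + z) = dot v u * k.
Proof.
move=> Fx sx Fz; rewrite raddfD /= (sat_perp sx Fz) addr0 -lin_ext_adj Fx.
exact: dotMzl.
Qed.

(** The group [Z^S / (im Ft + ker F)] is isomorphic to its dual, and the dual is
    [sat (im F) / F (sat (im Ft))]; [delta] induces the isomorphism.  That of
    [lattice_self_dual] gives [phi], valued in the vectors pairing with the
    relations in [n Z]; [theta] corrects [phi] by multiples of [n] to make it
    orthogonal to [ker F].  Then [F \o theta] is divisible by [n], and [delta]
    is the quotient. *)
Lemma critical_duality : exists delta : {additive Z^S -> Z^T},
  [/\ forall x, sat F (delta x),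
      forall x, x \in crit_lattice f <-> exists2 s, sat Ft s & F s = delta x
    & forall v, sat F v -> exists x, delta x = v].
Proof.
have [n0 n0_gt0 n0P] := crit_lattice_exponent f.
pose n : int := n0; have n_neq0 : n != 0 by rewrite eqz_nat -lt0n.
have nP x : x *~ n \in crit_lattice f by rewrite -pmulrn.
have [g gP] := crit_lattice_generators f.
have [|phi [phi0 phin phi_surj]] := @lattice_self_dual _ _ g n n_neq0.
  by move=> x; apply/gP.
have [P [Q [FP Pid PQ]]] := ker_projection f.
have philat x y : y \in crit_lattice f -> (n %| dot (phi x) y)%Z.
  move=> /gP[u <-]; rewrite raddf_sum dvd_sum // => r /=.
  by rewrite dotMzr dvdz_mulr.
have kerlat z : F z = 0 -> z \in crit_lattice f.
  by move=> Fz; apply/crit_latticeP; exists 0, z; rewrite raddf0 add0r.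
pose theta x := phi x - Q (phi x).
have theta_sat x : sat Ft (theta x).
  apply: perp_ker => z Fz.
  by rewrite dotBl [dot (Q _) z]dotC -PQ Pid // dotC subrr.
have Qphi x : exists m, Q (phi x) = m *~ n.
  apply: dvd_vec => s; rewrite -dot_basisr dotC -PQ dotC philat //.
  exact/kerlat.
have theta_n x : exists v, F (theta x) = v *~ n.
  apply: dvd_vec => t; rewrite -dot_basisr lin_ext_adj dotBl; apply: rpredB.
    by apply: philat; apply/crit_latticeP; exists (basis_vec t), 0; rewrite raddf0 addr0.
  have [m ->] := Qphi x; rewrite dotMzl; exact: dvdz_mull.
have [d dP] := choice (fun s => theta_n (basis_vec s)).
have deltaE x : F (theta x) = lin_ext d x *~ n.
  have -> : F (theta x) = (F \o (phi \- (Q \o phi))) x by [].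
  rewrite additiveE mulrz_suml; apply: eq_bigr => s _.
  by rewrite -[RHS]mulrzA mulrC mulrzA -dP.
exists (lin_ext d); split=> [x|x|v [k k0 [y Fy]]].
- by exists n => //; exists (theta x); exact: deltaE.
- split=> [/gP/phi0[m phim]|[s ss Fs]].
    have theta_m : theta x = (m - Q m) *~ n by rewrite /theta phim raddfMz mulrzBl.
    exists (m - Q m); last by apply: (mulz_ffun_inj n_neq0); rewrite -deltaE theta_m raddfMz.
    apply: perp_ker => z Fz; apply: (mulIf n_neq0).
    by rewrite mul0r -dotMzl -theta_m (sat_perp (theta_sat x) Fz).
  apply/gP/phi0; have [m Qm] := Qphi x; exists (s + m).
  rewrite mulrzDl -Qm; apply/eqP; rewrite -subr_eq -/(theta x) -subr_eq0.
  apply/eqP/(@sat_ker0 _ _ f); last by rewrite raddfB /= deltaE raddfMz /= Fs subrr.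
  apply: perp_ker => z Fz; rewrite dotBl dotMzl (sat_perp (theta_sat x) Fz).
  by rewrite (sat_perp ss Fz) mul0r subrr.
have /crit_latticeP[u [z [Fz yn]]] := nP y.
have sat_Ftu : sat Ft (Ft u) by exists 1 => //; exists u.
have FFtu : F (Ft u) = v *~ n *~ k.
  by rewrite -[Ft u](addrK z) -yn raddfB /= Fz subr0 raddfMz Fy -!mulrzA mulrC.
(* [Ft u] pairs with [n Z^S], which consists of relations, in [n k Z]. *)
have [Y YE] : exists Y, Ft u = Y *~ k.
  apply: dvd_vec => s; rewrite -dot_basisr -(dvdz_mul2r n_neq0) -dotMzr.
  have /crit_latticeP[u' [z' [Fz' ->]]] := nP (basis_vec s).
  rewrite (dot_crit_lattice _ FFtu) // dotMzl -mulrA [n * k]mulrC.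
  exact: dvdz_mull.
have FY : F Y = v *~ n by apply: (mulz_ffun_inj k0); rewrite -FFtu YE raddfMz.
have sY : sat Ft Y by exists k => //; exists u.
have [|x phix] := phi_surj Y.
  move=> r; have : g r \in crit_lattice f by apply/gP; exists (basis_vec r); rewrite lin_ext_basis.
  by move=> /crit_latticeP[u' [z' [Fz' ->]]]; rewrite (dot_crit_lattice _ FY) // dvdz_mull.
exists x; apply: (mulz_ffun_inj n_neq0); rewrite -deltaE -FY /theta phix.
suff -> : Q Y = 0 by rewrite subr0.
apply/ffunP => s; rewrite ffunE -dot_basisr dotC -PQ dotC.
exact: sat_perp sY (FP _).
Qed.

(** A matrix and its transpose have the same elementary divisors, so that both
    images are saturated or none is.  Directly: as [Ft (c i)] is divisible by
    [d i], saturation yields [u] such that [c i - d i u] is in [ker Ft], hence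
    orthogonal to [x], and [dot x (c i)] is a multiple of [d i]. *)
Lemma sat_im_of_tr :
  (forall y, sat Ft y -> exists u, Ft u = y) ->
  forall x, sat F x -> exists y, F y = x.
Proof.
move=> satt x [k k0 [y Fy]].
have [b [c [d [_ _ imP]]]] := stacked_basis f.
apply/imP => i.
have [u cu] : exists u, Ft (c i) = Ft (u *~ d i).
  have [di|di] := eqVneq (d i) 0.
    exists 0; rewrite di mulr0z raddf0; apply: dot_eq0; rewrite -lin_ext_adj.
    have [/(_ (ex_intro _ _ erefl))] := imP (F (Ft (c i))).
    by move/(_ i); rewrite di dvd0z => /eqP.
  have [w cw] : exists w, Ft (c i) = w *~ d i.
    apply: dvd_vec => s; rewrite lin_ext_trE.
    by apply: (proj1 (imP _)); exists (basis_vec s); rewrite lin_ext_basis.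
  have [|u uw] := satt w; first by exists (d i) => //; exists (c i).
  by exists u; rewrite raddfMz /= uw.
suff -> : dot x (c i) = dot x (u *~ d i) by rewrite dotMzr dvdz_mull.
by apply: (mulIf k0); rewrite -!dotMzl -Fy !lin_ext_adj cu.
Qed.

End Duality.

(** * Quotients and short exact sequences of abelian groups *)

Lemma factor_additive (X A B : zmodType) (f : {additive X -> A}) (g : {additive X -> B}) :
  (forall a, exists x, f x = a) -> (forall x, f x = 0 -> g x = 0) ->
  exists h : {additive A -> B}, forall x, h (f x) = g x.
Proof.
move=> fsurj fg; have [s sK] := choice fsurj.
have gs x : g (s (f x)) = g x.
  by apply/eqP; rewrite -subr_eq0 -raddfB fg // raddfB /= sK subrr.
have add : zmod_morphism (g \o s).
  move=> a b /=; have -> : a - b = f (s a - s b) by rewrite raddfB /= !sK.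
  by rewrite gs raddfB.
pose H := GRing.isZmodMorphism.Build A B (g \o s) add.
by exists (HB.pack_for {additive A -> B} (g \o s) H).
Qed.

(** If the composite [q \o t] is multiplication by 2 and [p] is odd, then
    [t] times an inverse of 2 modulo the [p]-part of the exponent of [C] is a
    section of [q] on [p]-primary parts. *)
Lemma split_pprim_of_transfer (A B C : zmodType) (i : {additive A -> B})
    (q : {additive B -> C}) (t : {additive C -> B}) (n p : nat) :
  short_exact i q -> (0 < n)%N -> (forall c : C, c *+ n = 0) ->
  (forall c, q (t c) = c *+ 2) -> prime p -> odd p ->
  split_short_exact (pprim_map p i) (pprim_map p q).
Proof.
move=> [inj ker_im _] n0 nC qt p_pr p_odd.
pose m := (p ^ logn p n).+1./2.
have m2 : (m * 2 = (p ^ logn p n).+1)%N.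
  by rewrite muln2 /m -[RHS]odd_double_half /= oddX p_odd orbT.
have tm_add : zmod_morphism (fun c => t c *+ m).
  by move=> c c'; rewrite raddfB mulrnBl.
pose tm := HB.pack_for {additive C -> B} (fun c => t c *+ m)
  (GRing.isZmodMorphism.Build C B _ tm_add).
pose s : {additive pprimary p C -> pprimary p B} := pprim_map p tm.
have sK : cancel s (pprim_map p q).
  move=> [c cp]; apply: val_inj => /=.
  rewrite raddfMn /= qt -mulrnA [(2 * m)%N]mulnC m2 mulrS.
  suff -> : c *+ (p ^ logn p n) = 0 by rewrite addr0.
  move/asboolP: cp => [k ck].
  (* [c] is killed by [n] and by some power of [p], hence by the [p]-part of
     [n]. *)
  have : c *+ gcdn n (p ^ k) = 0.
    have [u v uv _] := egcdnP (p ^ k) n0.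
    have : c *+ (u * n) = 0 by rewrite mulnC mulrnA nC mul0rn.
    by rewrite uv mulrnDr [(v * _)%N]mulnC mulrnA ck mul0rn add0r.
  have /dvdnP[w ->] : (gcdn n (p ^ k) %| p ^ logn p n)%N.
    have /(dvdn_pfactor _ _ p_pr)[l _ gl] := dvdn_gcdr n (p ^ k).
    rewrite gl dvdn_exp2l // -(pfactorK l p_pr) -gl dvdn_leq_log //.
    exact: dvdn_gcdl.
  by move=> g0; rewrite mulnC mulrnA g0 mul0rn.
split; last by exists s.
split=> [a a' /(congr1 val) /inj /val_inj //|b|c]; last by exists (s c); apply: sK.
split=> [/(congr1 val) /ker_im[a ia]|[a <-]]; last first.
  by apply: val_inj => /=; apply/ker_im; exists (val a).
have ap : a \in pprim A p.
  case/asboolP: (valP b) => k bk; apply/asboolP; exists k.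
  by apply: inj; rewrite raddfMn /= ia bk raddf0.
by exists (exist _ a ap); apply: val_inj.
Qed.

Lemma short_exact_order (A B C : zmodType) (i : {additive A -> B}) (q : {additive B -> C}) :
  short_exact i q -> finite_set [set: A]%classic -> finite_set [set: C]%classic ->
  finite_set [set: B]%classic /\ group_order B = (group_order A * group_order C)%N.
Proof.
move=> [inj ker_im surj] finA finC; have [s sK] := choice surj.
pose X := fset_set [set: A]%classic; pose Y := fset_set [set: C]%classic.
pose h (u : A * C) := i u.1 + s u.2.
have qh u : q (h u) = u.2.
  by rewrite raddfD /= sK (proj2 (ker_im _)) ?add0r //; exists u.1.
have h_inj : injective h.
  move=> [a c] [a' c'] e; have := congr1 q e; rewrite !qh /= => ec.
  by rewrite -ec in e *; move: e => /addIr/inj /= ->.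
pose r := [seq h u | u <- [seq (a, c) | a <- X, c <- Y]].
have ur : uniq r.
  by rewrite map_inj_uniq // allpairs_uniq ?fset_uniq // => -[? ?] [? ?] _ _ [-> ->].
have ZT : [set: B]%classic = [set` [fset b in r]%fset]%classic.
  apply/seteqP; split=> // b _ /=; rewrite inE; apply/mapP.
  have [|a ia] := proj1 (ker_im (b - s (q b))); first by rewrite raddfB /= sK subrr.
  exists (a, q b); last by rewrite /h /= ia subrK.
  by apply: allpairs_f; rewrite in_fset_set ?mem_set.
split; first by rewrite ZT; exact: finite_fset.
by rewrite /group_order ZT set_fsetK card_fseq undup_id // size_map size_allpairs.
Qed.

Section Quotient.
Variables (A : zmodType) (I : zmodClosed A).

Definition quot_class (x : A) : {ideal_quot I} := \pi_{ideal_quot I}%qT x.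

Lemma quot_class_is_zmod_morphism : zmod_morphism quot_class.
Proof. by move=> x y; rewrite /quot_class !piE. Qed.
HB.instance Definition _ :=
  GRing.isZmodMorphism.Build A {ideal_quot I} quot_class quot_class_is_zmod_morphism.

Lemma quot_class_eq0 x : quot_class x = 0 <-> x \in I.
Proof.
have -> : (x \in I) = (quot_class x == quot_class 0).
  by rewrite -Quotient.idealrBE subr0.
by rewrite raddf0; split=> /eqP.
Qed.

Lemma quot_class_surj a : exists x, quot_class x = a.
Proof. by exists (repr a); rewrite /quot_class reprK. Qed.
End Quotient.

(** * The two sheets of a double cover *)

Section Sheets.
Variable X : finType.
Implicit Types (x : Z^X) (y : Z^(X * bool)%type).

Definition anti x : Z^(X * bool)%type := [ffun u => if u.2 then x u.1 else - x u.1].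
Definition pull x : Z^(X * bool)%type := [ffun u => x u.1].
Definition push y : Z^X := [ffun v => y (v, true) + y (v, false)].
Definition diff y : Z^X := [ffun v => y (v, true) - y (v, false)].
Definition upper x : Z^(X * bool)%type := [ffun u => if u.2 then x u.1 else 0].

Lemma anti_is_zmod_morphism : zmod_morphism anti.
Proof. by move=> x y; apply/ffunP => -[v b]; rewrite !ffunE; case: b => //=; ring. Qed.
HB.instance Definition _ := GRing.isZmodMorphism.Build _ _ anti anti_is_zmod_morphism.

Lemma pull_is_zmod_morphism : zmod_morphism pull.
Proof. by move=> x y; apply/ffunP => u; rewrite !ffunE. Qed.
HB.instance Definition _ := GRing.isZmodMorphism.Build _ _ pull pull_is_zmod_morphism.

Lemma push_is_zmod_morphism : zmod_morphism push.
Proof. by move=> x y; apply/ffunP => v; rewrite !ffunE; ring. Qed.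
HB.instance Definition _ := GRing.isZmodMorphism.Build _ _ push push_is_zmod_morphism.

Lemma diff_is_zmod_morphism : zmod_morphism diff.
Proof. by move=> x y; apply/ffunP => v; rewrite !ffunE; ring. Qed.
HB.instance Definition _ := GRing.isZmodMorphism.Build _ _ diff diff_is_zmod_morphism.

Lemma sum_sheets (F : X * bool -> int) : \sum_u F u = \sum_v (F (v, true) + F (v, false)).
Proof.
rewrite (eq_bigr (fun u => F (u.1, u.2))) => [|[v b] _ //].
rewrite -(pair_bigA _ (fun v b => F (v, b))) /=; apply: eq_bigr => v _.
exact: big_bool.
Qed.

Lemma dot_anti x y : dot (anti x) y = dot x (diff y).
Proof.
by rewrite /dot sum_sheets; apply: eq_bigr => v _; rewrite !ffunE /=; ring.
Qed.

Lemma dot_pull x y : dot (pull x) y = dot x (push y).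
Proof.
by rewrite /dot sum_sheets; apply: eq_bigr => v _; rewrite !ffunE /=; ring.
Qed.

Lemma push_anti x : push (anti x) = 0.
Proof. by apply/ffunP => v; rewrite !ffunE subrr. Qed.

Lemma diff_anti x : diff (anti x) = x *~ 2.
Proof. by apply/ffunP => v; rewrite ffunMz !ffunE /=; ring. Qed.

Lemma push_pull x : push (pull x) = x *+ 2.
Proof. by apply/ffunP => v; rewrite !ffunE. Qed.

Lemma push_upper x : push (upper x) = x.
Proof. by apply/ffunP => v; rewrite !ffunE /= addr0. Qed.

Lemma push_eq0 y : push y = 0 -> exists x, y = anti x.
Proof.
move=> /ffunP y0; exists [ffun v => y (v, true)]; apply/ffunP => -[v b].
have := y0 v; rewrite !ffunE /=; case: b => // /eqP.
by rewrite addrC addr_eq0 => /eqP.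
Qed.

Lemma anti_inj : injective anti.
Proof.
move=> x y /(congr1 diff); rewrite !diff_anti; exact: mulz_ffun_inj.
Qed.

End Sheets.

Lemma dot_inj (T : finType) (x y : Z^T) : (forall z, dot x z = dot y z) -> x = y.
Proof. by move=> xy; apply/ffunP => t; rewrite -!dot_basisr. Qed.

(** * Boundaries and coboundaries of graphs *)

Lemma coboundaryE (G : multigraph) u e :
  coboundary G u e = u (src e) - u (tgt e).
Proof. by rewrite lin_ext_trE dotBl ![dot _ u]dotC !dot_basisr. Qed.

Lemma signed_coboundaryE (G : signed_graph) u (e : edge G) :
  signed_coboundary G u e =
    if is_positive e then u (src e) - u (tgt e) else u (src e) + u (tgt e).
Proof.
rewrite lin_ext_trE /signed_incidence; case: is_positive.
  by rewrite dotBl ![dot _ u]dotC !dot_basisr.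
by rewrite dotDl ![dot _ u]dotC !dot_basisr.
Qed.

Lemma boundary_adj (G : multigraph) x y :
  dot (boundary G x) y = dot x (coboundary G y).
Proof. exact: lin_ext_adj. Qed.

Lemma signed_boundary_adj (G : signed_graph) x y :
  dot (signed_boundary G x) y = dot x (signed_coboundary G y).
Proof. exact: lin_ext_adj. Qed.

(** If [u] is a potential whose differences along edges are all multiples of
    [k], then its values at the two ends of an edge have the same remainder, so
    the rounded quotients [u v %/ k] have the divided differences.  The argument
    fails for signed graphs, where the sum of the values occurs on negative edges. *)
Lemma sat_coboundary (G : multigraph) y :
  sat (coboundary G) y -> exists u, coboundary G u = y.
Proof.
move=> [k k0 [u uy]]; exists [ffun v => (u v %/ k)%Z]; apply/ffunP => e.
have := congr1 (fun z : Z^(edge G) => z e) uy.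
rewrite /= !coboundaryE ffunMz !ffunE => /eqP; rewrite subr_eq => /eqP ->.
by rewrite divzMDl // addrK.
Qed.

Lemma sat_boundary (G : multigraph) x :
  sat (boundary G) x -> exists y, boundary G y = x.
Proof. by apply: sat_im_of_tr; exact: sat_coboundary. Qed.

(** * The double cover of a signed graph *)

Section Cover.
Variable G : signed_graph.
Local Notation H := (double_cover G).

(** Restated with the edges of the cover as a product type, the form in which
    the operations on sheets see them. *)
Lemma cover_coboundaryE u e b : (coboundary H u : Z^(edge G * bool)%type) (e, b) =
  u (src e, b) - u (tgt e, if is_positive e then b else ~~ b).
Proof. exact: (@coboundaryE H). Qed.

Lemma push_coboundary u : push (coboundary H u : Z^(edge G * bool)%type) = coboundary G (push u).
Proof.
apply/ffunP => e; rewrite coboundaryE ffunE !cover_coboundaryE !ffunE /=.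
case: is_positive => /=; ring.
Qed.

Lemma diff_coboundary u : diff (coboundary H u : Z^(edge G * bool)%type) = signed_coboundary G (diff u).
Proof.
apply/ffunP => e; rewrite signed_coboundaryE ffunE !cover_coboundaryE !ffunE /=.
case: is_positive => /=; ring.
Qed.

Lemma coboundary_pull u : coboundary H (pull u) = pull (coboundary G u).
Proof. by apply/ffunP => -[e b]; rewrite (cover_coboundaryE (pull u)) !ffunE coboundaryE. Qed.

Lemma coboundary_anti u : coboundary H (anti u) = anti (signed_coboundary G u).
Proof.
apply/ffunP => -[e b]; rewrite (cover_coboundaryE (anti u)) !ffunE signed_coboundaryE /=.
by case: is_positive; case: b => /=; ring.
Qed.

(** The identities for boundaries are the transposes of those for
    coboundaries. *)
Lemma boundary_anti x : boundary H (anti x) = anti (signed_boundary G x).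
Proof.
apply: dot_inj => u; rewrite (@boundary_adj H) !dot_anti signed_boundary_adj.
by rewrite diff_coboundary.
Qed.

Lemma boundary_pull x : boundary H (pull x) = pull (boundary G x).
Proof. by apply: dot_inj => u; rewrite (@boundary_adj H) !dot_pull boundary_adj push_coboundary. Qed.

Lemma push_boundary y : push (boundary H y : Z^(vertex G * bool)%type) = boundary G (push y).
Proof.
apply: dot_inj => u; rewrite dotC -dot_pull dotC (@boundary_adj H) coboundary_pull.
by rewrite dotC dot_pull dotC boundary_adj.
Qed.

Lemma diff_boundary y : diff (boundary H y : Z^(vertex G * bool)%type) = signed_boundary G (diff y).
Proof.
apply: dot_inj => u; rewrite dotC -dot_anti dotC (@boundary_adj H) coboundary_anti.
by rewrite dotC dot_anti dotC signed_boundary_adj.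
Qed.

Lemma cover_mapE y : cover_map G y = push y.
Proof.
apply/ffunP => e; rewrite lin_extE sum_sheets ffunE (bigD1 e) //= big1 => [|e' ne].
  by rewrite !ffunE eqxx !mul1r addr0.
by rewrite !ffunE eq_sym (negPf ne) !mul0r addr0.
Qed.

(** The numerator of the kernel of the covering map.  If [anti v] is the boundary
    of [c], then [2 v] is the signed boundary of [diff c]; conversely, if
    [y] has signed boundary [k v], then [anti y] has boundary [k (anti v)], and
    boundaries on an unsigned graph are saturated. *)
Lemma anti_boundaryP v :
  sat (signed_boundary G) v <-> exists c, boundary H c = anti v.
Proof.
split=> [[k k0 [y yv]]|[c cv]].
  by apply: sat_boundary; exists k => //; exists (anti y); rewrite boundary_anti yv raddfMz.
by exists 2 => //; exists (diff c); rewrite -diff_boundary cv diff_anti.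
Qed.

(** The denominator of the kernel of the covering map.  If the Laplacian of [u]
    is antisymmetric, then [push u] has zero Laplacian on [G], hence zero
    coboundary, so the coboundary of [u] is itself antisymmetric. *)
Lemma anti_laplacianP v :
  (exists u, boundary H (coboundary H u) = anti v) <->
  exists2 s, sat (signed_coboundary G) s & signed_boundary G s = v.
Proof.
split=> [[u uv]|[s [k k0 [u us]] <-]].
  have push0 : coboundary G (push u) = 0.
    apply: (@sat_ker0 _ _ (@incidence G)); first by exists 1 => //; exists (push u).
    by rewrite -[LHS]/(boundary G _) -push_coboundary -push_boundary uv push_anti.
  have [s us] : exists s, coboundary H u = anti s.
    by apply: push_eq0; rewrite push_coboundary.
  exists s; last by apply: anti_inj; rewrite -boundary_anti -us.
  by exists 2 => //; exists (diff u); rewrite -diff_coboundary us diff_anti.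
have [|w ws] := @sat_coboundary H (anti s).
  by exists k => //; exists (anti u); rewrite coboundary_anti us raddfMz.
by exists w; rewrite ws boundary_anti.
Qed.

End Cover.

(** * Critical groups as quotients *)

(** Passes between presentations by edges, which define unsigned critical groups,
    and by vertices, which define signed ones. *)
Lemma crit_lattice_laplacianP (S T : finType) (f : S -> Z^T) x :
  x \in crit_lattice f <-> exists u, lin_ext f (lin_ext_tr f u) = lin_ext f x.
Proof.
split=> [/crit_latticeP[u [z [fz ->]]]|[u ux]].
  by exists u; rewrite raddfD /= fz addr0.
apply/crit_latticeP; exists u, (x - lin_ext_tr f u); split; last by rewrite subrKC.
by rewrite raddfB /= ux subrr.
Qed.

(** The map [crit_class], as a morphism of groups. *)
Definition crit_quot (G : multigraph) : {additive Z^(edge G) -> crit G} :=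
  @quot_class _ (crit_relations G).

Lemma crit_quot_eq0 (G : multigraph) x :
  crit_quot G x = 0 <-> exists u, boundary G (coboundary G u) = boundary G x.
Proof. exact: iff_trans (quot_class_eq0 _ _) (crit_lattice_laplacianP (@incidence G) x). Qed.

Lemma crit_quot_surj (G : multigraph) (a : crit G) : exists x, crit_quot G x = a.
Proof. exact: quot_class_surj. Qed.

Lemma signed_crit_quot (G : signed_graph) :
  exists2 f : {additive Z^(edge G) -> signed_crit G}, forall a, exists x, f x = a
  & forall x, f x = 0 <-> x \in crit_lattice (@signed_incidence G).
Proof.
pose I := im (signed_boundary G).
have mem x : signed_boundary G x \in I by apply/asboolP; exists x.
pose f0 x : subgroup I := exist _ (signed_boundary G x) (mem x).
have f0_add : zmod_morphism f0 by move=> x y; apply: val_inj; rewrite /= raddfB.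
pose F0 := HB.pack_for {additive Z^(edge G) -> subgroup I} f0
  (GRing.isZmodMorphism.Build _ _ f0 f0_add).
pose J := within I (im (signed_boundary G \o signed_coboundary G)).
exists (@quot_class _ J \o F0) => [a|x].
  have [[v vI] <-] := quot_class_surj a; have /asboolP[x xv] := vI.
  by exists x => /=; congr quot_class; apply: val_inj.
apply: iff_trans (quot_class_eq0 _ _) _.
apply: iff_trans (iff_sym (crit_lattice_laplacianP _ x)).
by split=> [/asboolP//|ex]; apply/asboolP.
Qed.

Lemma crit_exponent (G : multigraph) :
  exists2 n : nat, (0 < n)%N & forall a : crit G, a *+ n = 0.
Proof.
have [n n0 nP] := crit_lattice_exponent (@incidence G); exists n => // a.
have [x <-] := crit_quot_surj a; rewrite -raddfMn.
by apply/quot_class_eq0; apply: nP.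
Qed.

(** Every class is represented by a vector with coordinates in [0, n). *)
Lemma finite_of_exponent (T : finType) (A : zmodType) (f : {additive Z^T -> A}) (n : nat) :
  (0 < n)%N -> (forall a, exists x, f x = a) -> (forall x, f (x *+ n) = 0) ->
  finite_set [set: A]%classic.
Proof.
move=> n0 surj fn.
pose h (u : {ffun T -> 'I_n}) : A := f [ffun t => (u t : nat)%:Z].
apply: (@sub_finite_set _ _ (h @` [set: {ffun T -> 'I_n}])%classic); last first.
  by apply: finite_image; exact: finite_finset.
move=> a _; have [x <-] := surj a.
have lt t : (`|(x t %% n)%Z| < n)%N.
  by rewrite -ltz_nat gez0_abs ?modz_ge0 ?ltz_pmod // -?lt0n // eqz_nat -lt0n.
exists [ffun t => Ordinal (lt t)] => //; apply/eqP.
rewrite -subr_eq0 -oppr_eq0 opprB -raddfB.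
suff -> : x - [ffun t => ([ffun t => Ordinal (lt t)] t : nat)%:Z] = [ffun t => (x t %/ n)%Z] *+ n.
  by rewrite fn.
apply/ffunP => t; rewrite pmulrn ffunMz !ffunE /= gez0_abs ?modz_ge0 -?lt0n //.
by rewrite {1}(divz_eq (x t) n) addrK.
Qed.

Lemma finite_crit (G : multigraph) : finite_set [set: crit G]%classic.
Proof.
have [n n0 nP] := crit_exponent G.
by apply: (finite_of_exponent (f := crit_quot G) n0) => [a|x];
  [exact: crit_quot_surj|rewrite raddfMn].
Qed.

Lemma finite_signed_crit (G : signed_graph) : finite_set [set: signed_crit G]%classic.
Proof.
have [n n0 nP] := crit_lattice_exponent (@signed_incidence G).
have [f fsurj f0] := signed_crit_quot G.
by apply: (finite_of_exponent n0 fsurj) => x; apply/f0.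
Qed.

(** * The exact sequence *)

Section Sequence.
Variable G : signed_graph.
Local Notation H := (double_cover G).

Lemma covering_surjection : exists2 q : {additive crit H -> crit G},
  forall x, q (crit_quot H x) = crit_quot G (cover_map G x)
  & forall c, exists b, q b = c.
Proof.
have [|x /crit_quot_eq0[u ux]|q qE] :=
  @factor_additive _ _ _ (crit_quot H) (crit_quot G \o cover_map G).
- exact: crit_quot_surj.
- apply/crit_quot_eq0; exists (push u).
  by rewrite cover_mapE -push_coboundary -!push_boundary ux.
exists q => // c; have [x <-] := crit_quot_surj c.
exists (crit_quot H (upper x)); rewrite qE /= cover_mapE; congr (crit_quot G _).
exact: push_upper.
Qed.

Lemma transfer : exists t : {additive crit G -> crit H},
  forall x, t (crit_quot G x) = crit_quot H (pull x).
Proof.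
apply: (@factor_additive _ _ _ (crit_quot G) (crit_quot H \o @pull _)).
  exact: crit_quot_surj.
move=> x /crit_quot_eq0[u ux]; apply/crit_quot_eq0; exists (pull u).
by rewrite coboundary_pull !boundary_pull ux.
Qed.

(** [delta] identifies [signed_crit G] with the dual description of the kernel;
    [w] lifts [delta] to edge vectors of the cover whose boundary is [anti] of
    [delta].  For exactness in the middle, a class that dies in [crit G] is moved
    by a coboundary of the cover until its push-forward is a cycle, so that its
    boundary becomes antisymmetric. *)
Lemma covering_sequence (q : {additive crit H -> crit G}) :
  (forall x, q (crit_quot H x) = crit_quot G (cover_map G x)) ->
  (forall c, exists b, q b = c) ->
  exists i : {additive signed_crit G -> crit H}, short_exact i q.
Proof.
move=> qE q_surj.
have [f f_surj f0] := signed_crit_quot G.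
have [delta [delta_sat deltaP delta_surj]] := critical_duality (@signed_incidence G).
have [w0 w0P] := choice (fun e => proj1 (anti_boundaryP _) (delta_sat (basis_vec e))).
pose w : {additive Z^(edge G) -> Z^(edge H)} := lin_ext w0.
have wE x : boundary H (w x) = anti (delta x).
  apply: (@additive_ext _ _ (boundary H \o w) (@anti _ \o delta)) => e.
  by rewrite /= /w /= lin_ext_basis; apply: w0P.
have w_eq0 x : crit_quot H (w x) = 0 <-> f x = 0.
  apply: iff_trans (crit_quot_eq0 _) _; rewrite wE.
  by apply: iff_trans (anti_laplacianP _) _; split=> [/deltaP/f0|/f0/deltaP].
have [|i iE] := factor_additive (g := crit_quot H \o w) f_surj.
  by move=> x /w_eq0.
exists i; split=> //.
- apply: raddf_inj => a; have [x <-] := f_surj a.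
  by rewrite iE => /w_eq0.
move=> b; have [c <-] := crit_quot_surj b; split=> [|[a <-]]; last first.
  have [x <-] := f_surj a; rewrite iE qE; apply/crit_quot_eq0; exists 0.
  by rewrite !raddf0 cover_mapE -push_boundary wE push_anti.
rewrite qE => /crit_quot_eq0[u]; rewrite cover_mapE => uc.
pose c' := c - coboundary H (upper u).
have [v vc] : exists v, boundary H c' = anti v.
  apply: push_eq0; rewrite push_boundary raddfB /= push_coboundary push_upper.
  by rewrite raddfB /= uc subrr.
have [x xv] := delta_surj v (proj2 (anti_boundaryP _) (ex_intro _ _ vc)).
have wc : crit_quot H (w x - c) = 0.
  apply/crit_quot_eq0; exists (- upper u).
  have -> : boundary H (w x - c) = boundary H (c' - c) by rewrite [LHS]raddfB [RHS]raddfB /= wE xv vc.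
  by rewrite /c' addrAC subrr add0r !raddfN.
by exists (f x); rewrite iE; apply: subr0_eq; rewrite -wc raddfB.
Qed.

End Sequence.

Theorem theorem1p2 (G : signed_graph) :
  (exists (i : {additive signed_crit G -> crit (double_cover G)})
          (q : {additive crit (double_cover G) -> crit G}),
     [/\ forall x : Z^(edge (double_cover G)),
           q (crit_class x) = crit_class (cover_map G x),
         short_exact i q
       & forall p : nat, prime p -> odd p ->
           split_short_exact (pprim_map p i) (pprim_map p q)]) /\
  [/\ finite_set [set: signed_crit G]%classic,
      finite_set [set: crit (double_cover G)]%classic,
      finite_set [set: crit G]%classic
    & group_order (crit (double_cover G)) = (group_order (signed_crit G) * group_order (crit G))%N].
Proof.
have [q qE q_surj] := covering_surjection G.
have [i iq] := covering_sequence qE q_surj.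
have [t tE] := transfer G.
have [n n0 nP] := crit_exponent G.
have finK := finite_signed_crit G; have finG := finite_crit G.
have [finH orders] := short_exact_order iq finK finG.
split=> //; exists i, q; split=> // p p_pr p_odd.
apply: (split_pprim_of_transfer (t := t) iq n0 nP) => // c.
have [x <-] := crit_quot_surj c; rewrite tE qE -raddfMn; congr (crit_quot G _).
by rewrite cover_mapE push_pull.
Qed.
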